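(* For every $n\ge 4$, $pr(K_n,K_4^-)=\Big\lfloor\frac{3(n-1)}{2}\Big\rfloor$.
   Context: $K_4^-$ is the graph obtained from $K_4$ by deleting one edge. A subgraph of an edge-colored graph is properly colored if any two adjacent edges receive different colors. $pr(K_n,G)$ denotes the maximum number of colors in an (arbitrary) edge-coloring of the complete graph $K_n$ that contains no properly colored copy of $G$. *)

(* Defs.v *)
From mathcomp Require Import all_boot.

Set Implicit Arguments.
Unset Strict Implicit.
Unset Printing Implicit Defensive.

Record sgraph := SGraph {
  vertex : finType;
  edges : {set {set vertex}};
  card_edge : forall e, e \in edges -> #|e| = 2 }.

Lemma complete_card_edge (n : nat) (e : {set 'I_n}) :
  e \in [set e : {set 'I_n} | #|e| == 2] -> #|e| = 2.
Proof. by rewrite inE => /eqP. Qed.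

Definition complete (n : nat) : sgraph := SGraph (@complete_card_edge n).

Lemma del_edge_card_edge (G : sgraph) (a e : {set vertex G}) :
  e \in edges G :\ a -> #|e| = 2.
Proof. by case/setD1P=> _ /card_edge. Qed.

Definition del_edge (G : sgraph) (a : {set vertex G}) : sgraph :=
  SGraph (@del_edge_card_edge G a).

Definition K4minus : sgraph :=
  @del_edge (complete 4) [set (ord0 : 'I_4); (ord_max : 'I_4)].

(* An edge-coloring of H is a map on all vertex sets, of which only the values
   on edges of H are ever used. Since H is finite, nat provides enough colors. *)
Definition coloring (H : sgraph) := {set vertex H} -> nat.

Definition num_colors (H : sgraph) (c : coloring H) : nat :=
  size (undup [seq c e | e in edges H]).

Definition properly_colored (H : sgraph) (c : coloring H)
    (F : {set {set vertex H}}) : Prop :=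
  forall e1 e2, e1 \in F -> e2 \in F ->
    e1 != e2 -> e1 :&: e2 != set0 -> c e1 != c e2.

(* F is the edge set of a (not necessarily induced) subgraph of H that is
   isomorphic to G. *)
Definition is_copy (G H : sgraph) (F : {set {set vertex H}}) : Prop :=
  F \subset edges H /\
  exists f : vertex G -> vertex H,
    injective f /\ F = [set f @: (e : {set vertex G}) | e in edges G].

Definition pc_free (G H : sgraph) (c : coloring H) : Prop :=
  forall F, is_copy G F -> ~ properly_colored c F.

(* is_pr H G m reads pr(H, G) = m, a maximum over all edge-colorings of H. *)
Definition is_pr (H G : sgraph) (m : nat) : Prop :=
  (exists c : coloring H, pc_free G c /\ num_colors c = m) /\
  (forall c : coloring H, pc_free G c -> num_colors c <= m).

(* Main.v *)
(* Upper bound, by induction on a vertex set T. If some v has at most one colour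
   all of whose edges in T meet v, delete v. Otherwise draw an arc from v to x
   when the colour of vx is confined to the edges at v, and take a minimal
   nonempty set S closed under arcs. Forbidding properly coloured copies of
   K_4^- forces the arcs out of a vertex of S to have distinct colours, and then
   S contains a triangle vxy whose three colours occur nowhere else; every other
   vertex sees v, x and y in a single colour, so deleting v and x loses only
   those three colours.

   Lower bound: split the vertices into blocks {0}, {1,2}, {3,4}, ...; an edge
   between two blocks is coloured by its larger end, an edge inside a block gets
   its own colour. *)

Require Import Defs.
From mathcomp Require Import all_boot zify_ssreflect.

Set Implicit Arguments.
Unset Strict Implicit.
Unset Printing Implicit Defensive.

(* a and b are the two vertices of degree 3, pq is the missing edge. *)
Definition proper_K4minus (V K : eqType) (g : V -> V -> K) (a b p q : V) : bool :=
  uniq [:: a; b; p; q] &&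
  [&& uniq [:: g a b; g a p; g a q], uniq [:: g a b; g b p; g b q],
      g a p != g b p & g a q != g b q].

(** * Arcs: edges whose colour is confined to one end *)

Section UpperBound.

Variables (V K : finType) (g : V -> V -> K).
Hypothesis gC : forall x y, g x y = g y x.
Hypothesis no_K4minus : forall a b p q, ~~ proper_K4minus g a b p q.

Lemma K4minus_clash a b p q : uniq [:: a; b; p; q] ->
  g a b != g a p -> g a b != g a q -> g a b != g b p -> g a b != g b q ->
  g a p != g b p -> g a q != g b q -> g a p = g a q \/ g b p = g b q.
Proof.
move=> U n1 n2 n3 n4 n5 n6; have := no_K4minus a b p q.
rewrite /proper_K4minus U /= !inE !negb_or n1 n2 n3 n4 n5 n6 /= !andbT.
by rewrite -negb_or negbK => /orP[] /eqP; [left | right].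
Qed.

Definition cols (T : {set V}) : {set K} :=
  [set g e.1 e.2 | e in [set e : V * V | [&& e.1 \in T, e.2 \in T & e.1 != e.2]]].

Lemma colsP (T : {set V}) k :
  reflect (exists x y, [/\ x \in T, y \in T, x != y & k = g x y]) (k \in cols T).
Proof.
apply: (iffP imsetP) => [[[x y]] | [x [y [xT yT xy ->]]]].
  by rewrite inE /= => /and3P[xT yT xy] ->; exists x, y.
by exists (x, y); rewrite ?inE /= ?xT ?yT.
Qed.

Lemma mem_cols (T : {set V}) x y : x \in T -> y \in T -> x != y -> g x y \in cols T.
Proof. by move=> xT yT xy; apply/colsP; exists x, y. Qed.

Definition star (T : {set V}) (v : V) : {set K} := cols T :\: cols (T :\ v).

Definition arc (T : {set V}) (v x : V) : bool :=
  [&& v \in T, x \in T, v != x & g v x \notin cols (T :\ v)].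

Variable T : {set V}.

Lemma arcE v x : arc T v x -> [/\ v \in T, x \in T & v != x].
Proof. by case/and4P. Qed.

Lemma arc_neq v x a b : arc T v x -> a \in T -> b \in T -> a != b ->
  a != v -> b != v -> g v x != g a b.
Proof.
case/and4P=> _ _ _ /negP nin aT bT ab av bv; apply/negP => /eqP eqg.
by apply: nin; rewrite eqg; apply: mem_cols; rewrite // !inE ?av ?bv.
Qed.

Lemma starP v k : reflect (exists2 x, arc T v x & g v x = k) (k \in star T v).
Proof.
apply: (iffP setDP) => [[/colsP[x [y [xT yT xy ->]]] nin] | [x xarc <-]].
  case: (eqVneq x v) nin => [<- | xv] nin.
    by exists y; rewrite // /arc xT yT xy.
  case: (eqVneq y v) nin => [<- | yv] nin; last first.
    by case/negP: nin; apply: mem_cols; rewrite // !inE ?xv ?yv.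
  by exists x; rewrite 1?gC // /arc xT yT eq_sym xy gC.
by case/and4P: xarc => vT xT vx nin; split=> //; apply: mem_cols.
Qed.

Lemma arc_same_color v x w : arc T v x -> w \in T -> v != w -> g v w = g v x -> arc T v w.
Proof. by case/and4P=> vT _ _ nin wT vw eqg; rewrite /arc vT wT vw eqg. Qed.

(** Two would-be copies of $K_4^-$ on [v], [x], [y], [w] are excluded. With [v], [x] as the vertices
    of degree 3, every required inequality holds unless [g v w] repeats [g v x] or [g v y]; with
    [x], [y] in that role, only [g y w = g x y] can fail. *)
Lemma arc_exchange v x y w : arc T v x -> arc T v y -> g v x != g v y ->
    arc T x w -> g x w != g v x -> g x w != g x y ->
  [/\ g y w = g x y, arc T v w & g v w = g v x \/ g v w = g v y].
Proof.
move=> avx avy nxy axw n1 n2.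
have [vT xT vx] := arcE avx; have [_ yT vy] := arcE avy.
have [_ wT xw] := arcE axw.
have xy : x != y by apply: contraNneq nxy => ->.
have wv : v != w by apply: contraNneq n1 => <-; rewrite gC.
have wy : y != w by apply: contraNneq n2 => <-.
have [xv yv yx] : [/\ x != v, y != v & y != x] by split; rewrite eq_sym.
have [wx wv'] : w != x /\ w != v by split; rewrite eq_sym.
have B1 := arc_neq avx xT yT xy xv yv.
have B2 := arc_neq avy xT yT xy xv yv.
have B3 := arc_neq axw vT wT wv vx wx.
have B4 := arc_neq axw yT wT wy yx wx.
have B5 := arc_neq avy yT wT wy yv wv'.
have C : g v w = g v x \/ g v w = g v y.
  case: (eqVneq (g v w) (g v x)) => [|nw]; [by left | right].
  case: (@K4minus_clash v x y w) => //; try by rewrite eq_sym.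
  - by rewrite /= !inE !negb_or vx vy wv xy xw wy.
  - by move=> E; rewrite E eqxx in n2.
split=> //.
  apply/eqP/negPn/negP => nyw.
  case: (@K4minus_clash x y v w); rewrite ?[g x v]gC ?[g y v]gC //; try by rewrite eq_sym.
  - by rewrite /= !inE !negb_or xy xv xw yv wy wv.
  - by move=> E; rewrite E eqxx in n1.
  - by move=> E; rewrite E eqxx in B5.
by case: C; apply: arc_same_color.
Qed.

(** With arcs in both directions, the colour of each side is confined to the edges at both of its
    ends, so it occurs on no other edge inside [T]. *)
Definition unique_triangle v x y : bool :=
  [&& arc T v x, arc T x v, arc T v y, arc T y v, arc T x y & arc T y x].

Lemma star2 v k : 1 < #|star T v| -> exists2 x, arc T v x & g v x != k.
Proof.
move=> d2; have : 0 < #|star T v :\ k|.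
  by move: d2; rewrite (cardsD1 k); lia.
by case/card_gt0P=> k'; rewrite inE in_set1 => /andP[nk /starP[x ax eqk]]; exists x; rewrite ?eqk.
Qed.

(** * Minimal arc-closed sets *)

Section MinimalClosed.

Hypothesis star_gt1 : forall v, v \in T -> 1 < #|star T v|.

Definition arc_closed (S : {set V}) : bool :=
  [&& S != set0, S \subset T & [forall v in S, forall x, arc T v x ==> (x \in S)]].

Variable S : {set V}.
Hypothesis minS : minset arc_closed S.

(* If two out-neighbours of [v] share a colour, the out-neighbours of that colour
   form a smaller closed set. *)
Lemma minset_arc_inj v x x' : v \in S -> arc T v x -> arc T v x' ->
  g v x = g v x' -> x = x'.
Proof.
move=> vS avx avx' eqx; apply/eqP/negPn/negP => nx.
have [/and3P[_ /subsetP ST /forall_inP clS] mS] := minsetP minS.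
have [vT xT vx] := arcE avx.
have [y avy ny] := star2 (g v x) (star_gt1 vT).
have [_ yT vy] := arcE avy.
pose N := [set u | arc T v u && (g v u == g v x)].
have clN : arc_closed N.
  apply/and3P; split.
  - by apply/set0Pn; exists x; rewrite inE avx eqxx.
  - by apply/subsetP=> u; rewrite inE => /andP[/arcE[]].
  apply/forall_inP => u; rewrite inE => /andP[avu /eqP gu].
  (* A second vertex [u'] of [N] puts the colour of [vx] on the edge [vu'], which avoids [u]; hence
     no arc out of [u] has that colour. *)
  have [_ uT vu] := arcE avu.
  have [u' [avu' gu' uu']] : exists u', [/\ arc T v u', g v u' = g v x & u' != u].
    case: (eqVneq x u) => [xu | xu]; last by exists x.
    by exists x'; rewrite -xu eq_sym nx eqx.
  have [_ u'T vu'] := arcE avu'.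
  (* There is no arc from [u] to an out-neighbour [z] of [v] outside [N]: the exchange applied to a
     second colour at [u], on an arc to [w], gives [g z w = g u z], and the edge [zw] avoids [u]. *)
  have nuy (z : V) : arc T v z -> g v z != g v x -> ~~ arc T u z.
    move=> avz nz; have [_ zT vz] := arcE avz.
    have uz : u != z by apply: contraNneq nz => <-; rewrite gu.
    have [w auw nw] := star2 (g u z) (star_gt1 uT).
    have [_ wT uw] := arcE auw.
    have nw1 : g u w != g v u.
      by rewrite gu -gu'; apply: arc_neq => //; rewrite ?(eq_sym v) // eq_sym.
    have [] := arc_exchange avu avz _ auw nw1 nw; first by rewrite gu eq_sym.
    move=> gzw _ _; apply/negP => auz.
    have zw : z != w by apply: contraNneq nw => ->.
    have := arc_neq auz zT wT zw; rewrite gzw eqxx => H.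
    by move: H; rewrite ![_ == u]eq_sym uz uw => /(_ isT isT).
  apply/forallP => w; apply/implyP => auw.
  have [_ wT uw] := arcE auw.
  have nw1 : g u w != g v u.
    by rewrite gu -gu'; apply: arc_neq => //; rewrite ?(eq_sym v) // eq_sym.
  have auy := nuy y avy ny.
  have nw : g u w != g u y.
    have uy : u != y by apply: contraNneq ny => <-; rewrite gu.
    apply: contraNneq auy => eqg; exact: arc_same_color auw yT uy (esym eqg).
  (* The exchange makes [w] an out-neighbour of [v]; by [nuy] its colour there must be that of
     [N]. *)
  have [] := arc_exchange avu avy _ auw nw1 nw; first by rewrite gu eq_sym.
  move=> _ avw _; rewrite inE avw /=; apply: contraLR auw => nwx.
  exact: nuy.
have NS : N \subset S.
  apply/subsetP=> u; rewrite inE => /andP[avu _].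
  by move/forallP: (clS v vS) => /(_ u) /implyP; apply.
(* Minimality gives [N = S], but [v] is in [S] and has no arc to itself. *)
have vN : v \in N by rewrite (mS _ clN NS).
by move: vN; rewrite inE => /andP[/arcE[_ _]]; rewrite eqxx.
Qed.

(** An arc from [x] to [w] in a third colour would, by exchange, make [w] an out-neighbour of [v]
    sharing a colour with [x] or [y], hence equal to one of them, which is absurd. So only the
    colours of [vx] and [xy] are available for arcs out of [x], and since two are needed, both
    occur. *)
Lemma minset_out_arcs v x y : v \in S -> arc T v x -> arc T v y -> g v x != g v y ->
  arc T x v /\ arc T x y.
Proof.
move=> vS avx avy nxy.
have [vT xT vx] := arcE avx; have [_ yT vy] := arcE avy.
have xy : x != y by apply: contraNneq nxy => ->.
have out w : arc T x w -> g x w = g v x \/ g x w = g x y.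
  move=> axw; case: (eqVneq (g x w) (g v x)) => [|n1]; first by left.
  case: (eqVneq (g x w) (g x y)) => [|n2]; first by right.
  have [_ avw [] E] := arc_exchange avx avy nxy axw n1 n2.
    have [_ _] := arcE axw; by rewrite (minset_arc_inj vS avw avx E) eqxx.
  by move: n2; rewrite (minset_arc_inj vS avw avy E) eqxx.
split.
  have [w axw nw] := star2 (g x y) (star_gt1 xT).
  case: (out _ axw) => E; last by rewrite E eqxx in nw.
  by apply: arc_same_color axw vT _ _; rewrite 1?eq_sym // E gC.
have [w axw nw] := star2 (g v x) (star_gt1 xT).
case: (out _ axw) => E; first by rewrite E eqxx in nw.
exact: arc_same_color axw yT xy (esym E).
Qed.

End MinimalClosed.

(** * Triangles with unique colours and the induction *)

Lemma exists_unique_triangle : T != set0 -> (forall v, v \in T -> 1 < #|star T v|) ->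
  exists v x y, unique_triangle v x y.
Proof.
move=> T0 d2.
have clT : exists S, arc_closed S.
  exists T; rewrite /arc_closed T0 subxx /=.
  by apply/forall_inP => v vT; apply/forallP => x; apply/implyP => /arcE[].
have [S minS] := ex_minset clT.
have [/and3P[/set0Pn[v vS] /subsetP ST _] _] := minsetP minS.
have [k] : exists k, k \in star T v.
  by apply/card_gt0P; apply: ltnW; apply/d2/ST.
case/starP=> x avx _.
have [y avy] := star2 (g v x) (d2 v (ST v vS)).
rewrite eq_sym => nxy.
have [axv axy] := minset_out_arcs d2 minS vS avx avy nxy.
have [] := minset_out_arcs d2 minS vS avy avx; first by rewrite eq_sym.
by move=> ayv ayx; exists v, x, y; rewrite /unique_triangle avx axv avy ayv axy ayx.
Qed.

(** Otherwise [v], [x] as degree-3 vertices with [y], [u] would form a properly coloured $K_4^-$,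
    because the colours of the triangle differ from each other and from all other colours
    involved. *)
Lemma unique_triangle_twins v x y u : unique_triangle v x y -> u \in T ->
  u != v -> u != x -> u != y -> g v u = g x u.
Proof.
case/and5P=> avx axv avy ayv /andP[axy ayx] uT uv ux uy.
have [vT xT vx] := arcE avx; have [_ yT vy] := arcE avy; have [_ _ xy] := arcE axy.
have [vu xu yu] : [/\ v != u, x != u & y != u] by split; rewrite eq_sym.
have [yx xv yv] : [/\ y != x, x != v & y != v] by split; rewrite eq_sym.
have N1 := arc_neq axv vT uT vu vx ux.
have N2 := arc_neq avx xT uT xu xv uv.
have N3 := arc_neq ayv vT uT vu vy uy.
have N4 := arc_neq ayx xT uT xu xy uy.
have N5 := arc_neq axv vT yT vy vx yx.
have N6 := arc_neq avx xT yT xy xv yv.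
have N7 := arc_neq avy xT yT xy xv yv.
apply/eqP/negPn/negP => nvx.
rewrite [g x v]gC in N1 N5; rewrite [g y v]gC in N3; rewrite [g y x]gC in N4.
case: (@K4minus_clash v x y u) => //.
- by rewrite /= !inE !negb_or vx vy vu xy xu yu.
- by move=> E; rewrite E eqxx in N3.
- by move=> E; rewrite E eqxx in N4.
Qed.

Lemma cols_unique_triangle v x y : unique_triangle v x y ->
  cols T \subset cols (T :\ v :\ x) :|: (g v x |: [set g v y; g x y]).
Proof.
move=> tri; have /and5P[avx axv avy ayv /andP[axy ayx]] := tri.
have triv : unique_triangle v y x by rewrite /unique_triangle avx axv avy ayv axy ayx.
have trix : unique_triangle x y v by rewrite /unique_triangle avx axv avy ayv axy ayx.
have [vT xT vx] := arcE avx; have [_ yT vy] := arcE avy; have [_ _ xy] := arcE axy.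
have yT' : y \in T :\ v :\ x by rewrite !inE yT eq_sym xy eq_sym vy.
(* Outside the triangle, the colour of [vu] is also that of [yu], and [y] is kept. *)
have Cv u : u \in T -> u != v ->
    g v u \in cols (T :\ v :\ x) :|: (g v x |: [set g v y; g x y]).
  move=> uT uv; rewrite 4!inE.
  case: (eqVneq u x) => [-> | ux]; first by rewrite eqxx orbT.
  case: (eqVneq u y) => [-> | uy]; first by rewrite !inE eqxx !orbT.
  by rewrite (unique_triangle_twins triv) // mem_cols // ?inE ?ux ?uv // eq_sym.
have Cx u : u \in T -> u != x ->
    g x u \in cols (T :\ v :\ x) :|: (g v x |: [set g v y; g x y]).
  move=> uT ux; rewrite 4!inE.
  case: (eqVneq u v) => [-> | uv]; first by rewrite gC eqxx orbT.
  case: (eqVneq u y) => [-> | uy]; first by rewrite !inE eqxx !orbT.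
  by rewrite (unique_triangle_twins trix) // mem_cols // ?inE ?ux ?uv // eq_sym.
apply/subsetP => k /colsP[a [b [aT bT ab ->]]].
case: (eqVneq a v) => [av | av]; first by rewrite av Cv // -av eq_sym.
case: (eqVneq b v) => [bv | bv]; first by rewrite bv gC Cv // -bv.
case: (eqVneq a x) => [ax | ax]; first by rewrite ax Cx // -ax eq_sym.
case: (eqVneq b x) => [bx | bx]; first by rewrite bx gC Cx // -bx.
by rewrite inE mem_cols // !inE ?av ?bv ?ax ?bx.
Qed.

End UpperBound.

(** Removing a vertex with at most one private colour lowers the left side by at most 2 and the
    right side by 3; removing two vertices of a triangle lowers them by at most 6 and by exactly
    6. *)
Lemma cols_bound (V K : finType) (g : V -> V -> K)
    (gC : forall x y, g x y = g y x)
    (no_K4minus : forall a b p q, ~~ proper_K4minus g a b p q) (T : {set V}) :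
  T != set0 -> 2 * #|cols g T| + 3 <= 3 * #|T|.
Proof.
have [m] := ubnP #|T|; elim: m T => // m IH T ltTm T0.
case: (boolP [forall v in T, 1 < #|star g T v|]) => [/forall_inP d2 | ].
  have [v [x [y tri]]] := exists_unique_triangle gC no_K4minus T0 d2.
  have sub := cols_unique_triangle gC no_K4minus tri.
  have /and5P[avx axv avy ayv /andP[axy ayx]] := tri.
  have [vT xT vx] := arcE avx; have [_ yT vy] := arcE avy; have [_ _ xy] := arcE axy.
  have T'0 : T :\ v :\ x != set0.
    by apply/set0Pn; exists y; rewrite !inE yT eq_sym xy eq_sym vy.
  have cardT : #|T| = #|T :\ v :\ x| + 2.
    by rewrite (cardsD1 v T) vT (cardsD1 x (T :\ v)) 2!inE eq_sym vx xT /=; clear; lia.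
  have card3 : #|g v x |: [set g v y; g x y]| <= 3.
    by rewrite cardsU1 cards2; case: (_ \notin _); case: (_ != _).
  have sub3 := leq_trans (subset_leq_card sub) (leq_card_setU _ _).
  have lt' : #|T :\ v :\ x| < m by move: ltTm; rewrite cardT; clear; lia.
  by move: (IH _ lt' T'0) cardT card3 sub3; clear; lia.
rewrite negb_forall_in => /exists_inP[v vT d1].
have sub : #|cols g T| <= #|cols g (T :\ v)| + 1.
  rewrite -(cardsID (cols g (T :\ v)) (cols g T)); apply: leq_add.
    by apply/subset_leq_card/subsetIr.
  by rewrite -leqNgt in d1.
have cardT : #|T| = #|T :\ v| + 1 by rewrite (cardsD1 v T) vT addnC.
case: (eqVneq (T :\ v) set0) => [E | T'0]; last first.
  have lt' : #|T :\ v| < m by move: ltTm; rewrite cardT; clear; lia.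
  by move: (IH _ lt' T'0) cardT sub; clear; lia.
(* Base case: [T] is the singleton of [v], which spans no edge. *)
have -> : cols g T = set0.
  apply/setP => k; rewrite in_set0; apply/negP => /colsP[a [b [aT bT ab _]]].
  have eqv u : u \in T -> u = v.
    by move=> uT; apply/eqP; have := in_set0 u; rewrite -E !inE uT andbT => /negbFE.
  by rewrite (eqv a aT) (eqv b bT) eqxx in ab.
by rewrite cards0 cardT; clear; lia.
Qed.

(** * Copies of $K_4^-$ described by four vertices *)

Lemma edges_K4minusE : edges K4minus =
  let o (k : nat) : 'I_4 := inord k in
  [set [set o 1; o 2]; [set o 1; o 0]; [set o 1; o 3]; [set o 2; o 0]; [set o 2; o 3]].
Proof.
set o := fun k : nat => (inord k : 'I_4); cbv zeta.
have oE k : k < 4 -> val (o k) = k by move=> k4; apply: inordK.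
have o0 : ord0 = o 0 by apply: val_inj; rewrite oE.
have o3 : ord_max = o 3 by apply: val_inj; rewrite oE.
have onE i j : i < 4 -> j < 4 -> (o i == o j) = (i == j).
  by move=> i4 j4; rewrite -val_eqE !oE.
apply/setP => e; rewrite !inE o0 o3; apply/andP/idP.
  case=> ne /cards2P[i [j [ij eij]]]; move: ne ij; rewrite {e}eij.
  have [<- <-] : o (val i) = i /\ o (val j) = j by split; apply: inord_val.
  case: i => [[|[|[|[|i]]]] Hi] //; case: j => [[|[|[|[|j]]]] Hj] //=;
    (* Each pair appears in both orders; the swaps bring it to the order used in the list. *)
    rewrite ?eqxx //= 1?[[set o 0; o 1]]setUC 1?[[set o 2; o 1]]setUC
      1?[[set o 3; o 1]]setUC 1?[[set o 0; o 2]]setUC 1?[[set o 3; o 2]]setUC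
      1?[[set o 3; o 0]]setUC ?eqxx ?orbT //.
have H i j : i < 4 -> j < 4 -> i != j -> (i \in [:: 1; 2]) ->
    [set o i; o j] != [set o 0; o 3] /\ #|[set o i; o j]| == 2.
  move=> i4 j4 ij i12; rewrite cards2 onE // ij; split=> //.
  apply/eqP => /setP /(_ (o i)); rewrite !inE eqxx !onE //.
  by move: i12; rewrite !inE => /orP[] /eqP ->.
by case/orP=> [/orP[/orP[/orP[]|]|]|] /eqP ->; apply: H.
Qed.

Lemma set2_neq (V : finType) (a b p : V) : b != p -> [set a; b] != [set a; p].
Proof.
apply: contraNneq => /setP E; have := E b; have := E p.
rewrite !inE !eqxx !orbT => /orP[/eqP -> | /eqP -> //].
by rewrite orbb => /esym.
Qed.

Lemma set2_adj (V : finType) (a b p : V) : [set a; b] :&: [set a; p] != set0.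
Proof. by apply/set0Pn; exists a; rewrite !inE eqxx. Qed.

Lemma set2_disjoint (V : finType) (a b p q : V) :
  a != p -> a != q -> b != p -> b != q -> [set a; b] :&: [set p; q] = set0.
Proof.
move=> ap aq bp bq; apply/setP => z; rewrite !inE.
apply/negP => /andP[/orP[] /eqP ->]; apply/negP; by rewrite negb_or ?ap ?bp.
Qed.

Definition K4minus_edges (V : finType) (a b p q : V) : {set {set V}} :=
  [set [set a; b]; [set a; p]; [set a; q]; [set b; p]; [set b; q]].

Lemma in_K4minus_edges (V : finType) (a b p q : V) (e : {set V}) :
  e \in K4minus_edges a b p q =
  [|| e == [set a; b], e == [set a; p], e == [set a; q] |
      (e == [set b; p]) || (e == [set b; q])].
Proof. by rewrite !inE -!orbA. Qed.

Lemma copy_K4minusE (V : finType) (f : 'I_4 -> V) :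
  [set f @: (e : {set 'I_4}) | e in edges K4minus] =
  K4minus_edges (f (inord 1)) (f (inord 2)) (f (inord 0)) (f (inord 3)).
Proof. by rewrite edges_K4minusE /= !imsetU !imset_set1 !imsetU !imset_set1. Qed.

Lemma properly_colored_K4minus n (c : coloring (complete n)) (a b p q : 'I_n) :
  uniq [:: a; b; p; q] ->
  (properly_colored c (K4minus_edges a b p q) <->
   proper_K4minus (fun x y => c [set x; y]) a b p q).
Proof.
rewrite /proper_K4minus => U; rewrite U; move: U.
rewrite /= !inE !negb_or !andbT -!andbA => /and5P[ab ap aq bp /andP[bq pq]].
have [ba pa pb] : [/\ b != a, p != a & p != b] by split; rewrite eq_sym.
have [qa qb qp] : [/\ q != a, q != b & q != p] by split; rewrite eq_sym.
split=> [prop | /and5P[n1 n2 n3 n4 /and4P[n5 n6 n7 n8]] e1 e2].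
  have clash (x y z : 'I_n) : [set x; y] \in K4minus_edges a b p q ->
      [set x; z] \in K4minus_edges a b p q -> y != z -> c [set x; y] != c [set x; z].
    by move=> xy xz yz; apply: prop => //; [apply: set2_neq | apply: set2_adj].
  have mem : [/\ [set a; b] \in K4minus_edges a b p q, [set a; p] \in K4minus_edges a b p q,
      [set a; q] \in K4minus_edges a b p q, [set b; p] \in K4minus_edges a b p q &
      [set b; q] \in K4minus_edges a b p q].
    by rewrite !inE !eqxx !orbT.
  case: mem => m1 m2 m3 m4 m5; rewrite !clash //=.
  have mC x y : [set x; y] \in K4minus_edges a b p q -> [set y; x] \in K4minus_edges a b p q.
    by rewrite setUC.
  have := clash _ _ _ (mC _ _ m1) m4 ap; rewrite [[set b; a]]setUC => ->.
  have := clash _ _ _ (mC _ _ m1) m5 aq; rewrite [[set b; a]]setUC => ->.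
  have := clash _ _ _ (mC _ _ m2) (mC _ _ m4) ab; rewrite ![[set p; _]]setUC => ->.
  by have := clash _ _ _ (mC _ _ m3) (mC _ _ m5) ab; rewrite ![[set q; _]]setUC => ->.
(* Of the ten pairs of edges only [ap], [bq] and [aq], [bp] are disjoint; the other eight are the
   inequalities of [proper_K4minus]. *)
have D1 := set2_disjoint ab aq pb pq; have D2 := set2_disjoint ab ap qb qp.
have D3 : [set b; q] :&: [set a; p] = set0 by rewrite setIC.
have D4 : [set b; p] :&: [set a; q] = set0 by rewrite setIC.
rewrite !in_K4minus_edges => /or4P[||| /orP[]] /eqP -> /or4P[||| /orP[]] /eqP ->;
  rewrite ?D1 ?D2 ?D3 ?D4 ?eqxx // => _ _; by rewrite // eq_sym.
Qed.

Lemma pc_freeP n (c : coloring (complete n)) :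
  pc_free K4minus c <->
  forall a b p q, ~~ proper_K4minus (fun x y => c [set x; y]) a b p q.
Proof.
split=> [free a b p q | nproper F [_ [f [f_inj ->]]]]; last first.
  rewrite copy_K4minusE => prop.
  have U : uniq [seq f i | i <- [:: inord 1; inord 2; inord 0; inord 3]].
    by rewrite map_inj_uniq // /= !inE -!val_eqE /= !inordK.
  exact: (negP (nproper _ _ _ _)) ((properly_colored_K4minus c U).1 prop).
apply/negP => prop; have U : uniq [:: a; b; p; q] by case/andP: prop.
(* The deleted edge of [K4minus] joins 0 and 3, so these go to [p] and [q]. *)
pose f (i : 'I_4) := nth a [:: p; a; b; q] i.
have f_inj : injective f.
  move=> i j /eqP; rewrite nth_uniq ?ltn_ord //; first by move/eqP/val_inj.
  by rewrite -(perm_uniq (s1 := [:: a; b; p; q])) // (perm_catCA [:: a; b] [:: p]).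
apply: (free (K4minus_edges a b p q)); last exact: (properly_colored_K4minus c U).2.
split; last by exists f; split=> //; rewrite copy_K4minusE /f !inordK.
move: U; rewrite /= !inE !negb_or !andbT -!andbA => /and5P[ab ap aq bp /andP[bq pq]].
apply/subsetP => e; rewrite in_K4minus_edges inE => /or4P[||| /orP[]] /eqP ->;
  by rewrite cards2 ?ab ?ap ?aq ?bp ?bq.
Qed.

Lemma num_colors_bound n (c : coloring (complete n)) :
  0 < n -> pc_free K4minus c -> num_colors c <= (3 * (n - 1)) %/ 2.
Proof.
move=> n0 /pc_freeP free.
(* [cols_bound] needs a finite colour type; truncating at the largest value of [c] identifies no
   colours. *)
pose M := \max_(e : {set 'I_n}) c e.
pose g (x y : 'I_n) : 'I_M.+1 := inord (c [set x; y]).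
have gE x y : val (g x y) = c [set x; y].
  by rewrite /= inordK // ltnS (leq_bigmax [set x; y]).
have gC x y : g x y = g y x by rewrite /g setUC.
have free' a b p q : ~~ proper_K4minus g a b p q.
  by have := free a b p q; rewrite /proper_K4minus /= !inE -!gE !val_eqE.
have T0 : [set: 'I_n] != set0 by apply/set0Pn; exists (Ordinal n0).
have := cols_bound gC free' T0; rewrite cardsT card_ord => bound.
have le : num_colors c <= #|cols g setT|.
  rewrite cardE -(size_map val); apply: uniq_leq_size; first exact: undup_uniq.
  move=> k; rewrite mem_undup => /imageP[e]; rewrite inE => /cards2P[x [y [xy ->]]] ->.
  by rewrite -gE map_f // mem_enum mem_cols ?inE.
by apply: leq_trans le _; move: bound; move: #|_| => k; clear; lia.
Qed.

(** * The extremal block colouring *)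

(** The test recognises a block, consisting of an even number and its predecessor. For vertices
    below [n], the shift by [n] keeps block colours apart from all others. *)
Definition block_color (n i j : nat) : nat :=
  if ~~ odd (maxn i j) && ((minn i j).+1 == maxn i j) then n + maxn i j else maxn i j.

Lemma block_colorC n i j : block_color n i j = block_color n j i.
Proof. by rewrite /block_color maxnC minnC. Qed.

Lemma block_color_mate n t x y : x < t -> y < t -> block_color n t x != block_color n t y ->
  ~~ odd t /\ (x.+1 = t \/ y.+1 = t).
Proof.
move=> xt yt; rewrite /block_color (maxn_idPl (ltnW xt)) (minn_idPr (ltnW xt)).
rewrite (maxn_idPl (ltnW yt)) (minn_idPr (ltnW yt)).
case: (odd t) => /=; first by rewrite eqxx.
case: (x.+1 =P t) => [E|_]; first by split=> //; left.
case: (y.+1 =P t) => [E|_]; first by split=> //; right.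
by rewrite eqxx.
Qed.

Lemma block_color0 n k : block_color n 0 k = k.
Proof. by rewrite /block_color max0n min0n; case: k => [|[|k]] //; rewrite andbF. Qed.

Lemma block_color_pair n m : 0 < m -> block_color n m.*2.-1 m.*2 = n + m.*2.
Proof.
case: m => // m _; rewrite /block_color doubleS /=.
by rewrite (maxn_idPr (leqnSn _)) (minn_idPl (leqnSn _)) eqxx /= odd_double.
Qed.

(** A vertex distinguishes two smaller ones only if it is even and one of them is its predecessor.
    If [q] is largest, then [b] precedes it and must itself be even, a contradiction. If [b] is
    largest, it would distinguish all pairs among [a], [p], [q], but only one of these is its
    predecessor. *)
Lemma block_color_clash n a b p q : a < b -> p < q ->
  p != a -> q != a -> p != b -> q != b ->
  block_color n b a != block_color n b p -> block_color n b a != block_color n b q ->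
  block_color n b p != block_color n b q -> block_color n q a != block_color n q b -> False.
Proof.
move=> ab pq pa qa pb qb n1 n2 n3 n4; case: (ltngtP q b) => [ltqb | ltbq | E]; last first.
- by rewrite E eqxx in qb.
- have [evq aq] := block_color_mate (ltn_trans ab ltbq) ltbq n4.
  have bq : b.+1 = q by case: aq => // aq; move: ltbq; rewrite -aq ltnS leqNgt ab.
  have ltpb : p < b by rewrite ltn_neqAle pb -ltnS bq.
  have [evb _] := block_color_mate ab ltpb n1.
  by move: evq; rewrite -bq /= evb.
- have ltpb := ltn_trans pq ltqb.
  have [_ m1] := block_color_mate ab ltpb n1.
  have [_ m2] := block_color_mate ab ltqb n2.
  have [_ m3] := block_color_mate ltpb ltqb n3.
  by move: pq pa qa m1 m2 m3; clear; lia.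
Qed.

Lemma block_color_free n a b p q : ~~ proper_K4minus (block_color n) a b p q.
Proof.
apply/negP; rewrite /proper_K4minus /= !inE !negb_or !andbT -!andbA.
case/and5P=> ab ap aq bp /and5P[bq pq n1 n2 /and5P[n3 n4 n5 n6 /andP[n7 n8]]].
rewrite [block_color n a b]block_colorC in n4 n5.
rewrite ![block_color n _ p]block_colorC in n7.
rewrite ![block_color n _ q]block_colorC in n8.
have [pa qa] : p != a /\ q != a by split; rewrite eq_sym.
have [pb qb] : p != b /\ q != b by split; rewrite eq_sym.
case: (ltngtP a b) ab => [ltab | ltba | //] _; case: (ltngtP p q) pq => [ltpq | ltqp | //] _.
- exact: (@block_color_clash n a b p q).
- by apply: (@block_color_clash n a b q p); rewrite // eq_sym.
- by apply: (@block_color_clash n b a p q); rewrite // eq_sym.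
- by apply: (@block_color_clash n b a q p); rewrite // eq_sym.
Qed.

(** Symmetry of [block_color] makes the choice of ordered pair harmless; 0 is a dummy value for sets
    that are not of the form [[set x; y]]. *)
Definition block_coloring n : coloring (complete n) :=
  fun e => if [pick x : 'I_n * 'I_n | e == [set x.1; x.2]] is Some x
           then block_color n x.1 x.2 else 0.

Lemma block_coloringE n (x y : 'I_n) :
  block_coloring [set x; y] = block_color n x y.
Proof.
rewrite /block_coloring; case: pickP => [[u v] /= /eqP E | /(_ (x, y))]; last by rewrite eqxx.
have xin : x \in [set u; v] by rewrite -E set21.
have yin : y \in [set u; v] by rewrite -E set22.
have : u \in [set x; y] by rewrite E set21.
have : v \in [set x; y] by rewrite E set22.
case/set2P: xin => ->; case/set2P: yin => -> /set2P[] ? /set2P[] ?; subst => //;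
  by rewrite block_colorC.
Qed.

Lemma pc_free_block_coloring n : pc_free K4minus (@block_coloring n).
Proof.
apply/pc_freeP => a b p q; have := block_color_free n a b p q.
by rewrite /proper_K4minus /= !inE !block_coloringE !val_eqE.
Qed.

Lemma num_colors_block_coloring n :
  (3 * (n - 1)) %/ 2 <= num_colors (@block_coloring n).
Proof.
have colored (x y : 'I_n) : x < y ->
    block_color n x y \in undup [seq block_coloring e | e in edges (complete n)].
  move=> xy; rewrite mem_undup -block_coloringE; apply: image_f.
  by rewrite inE cards2 -val_eqE /= neq_ltn xy.
(* The colours [1], ..., [n - 1] appear on the edges at vertex 0, and [n + m.*2] appears inside the
   block of [m.*2]. *)
pose L := iota 1 (n - 1) ++ [seq n + m.*2 | m <- iota 1 ((n - 1) %/ 2)].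
have -> : (3 * (n - 1)) %/ 2 = size L.
  by rewrite size_cat size_map !size_iota; lia.
apply: uniq_leq_size => [|k].
  rewrite cat_uniq iota_uniq map_inj_uniq ?iota_uniq; last by move=> i j; lia.
  rewrite andbT; apply/hasPn => _ /mapP[m _ ->]; rewrite mem_iota; lia.
rewrite mem_cat => /orP[|/mapP[m]]; rewrite mem_iota => kn.
  have [n0 ltkn] : 0 < n /\ k < n by lia.
  have := colored (Ordinal n0) (Ordinal ltkn).
  rewrite /= block_color0.
  by apply; case/andP: kn.
move=> ->; have [lt1 lt2] : m.*2.-1 < n /\ m.*2 < n by lia.
have := colored (Ordinal lt1) (Ordinal lt2).
by rewrite /= block_color_pair; [apply; lia | lia].
Qed.

Theorem theorem5 (n : nat) (hn : 4 <= n) :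
  is_pr (complete n) K4minus ((3 * (n - 1)) %/ 2).
Proof.
have n0 : 0 < n by apply: leq_trans hn.
split=> [|c]; last exact: num_colors_bound.
exists (@block_coloring n); split; first exact: pc_free_block_coloring.
apply/eqP; rewrite eqn_leq num_colors_block_coloring andbT.
by apply: num_colors_bound => //; apply: pc_free_block_coloring.
Qed.
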